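(* Let $p,q\ge 0$ be integers with $n=p+q\in\{1,2,3\}$, and let $C\ell_{p,q}$ be the real Clifford algebra with orthogonal generators $e_1,\dots,e_n$, $e_k^2=\varepsilon_k$. The multivectors $A\in C\ell_{p,q}$ with $A^2=-1$ are exactly the following. (1) $n=1$. $C\ell_{1,0}$ contains no $A$ with $A^2=-1$. In $C\ell_{0,1}$ the only solutions are $A=\pm e_1$. (2) $n=2$. Write $A=\alpha+b_1e_1+b_2e_2+\beta e_{12}$ with $\alpha,b_1,b_2,\beta\in\mathbb{R}$. Then $A^2=-1$ if and only if $\alpha=0$ and $$\beta^2=b_1^2\varepsilon_2+b_2^2\varepsilon_1+\varepsilon_1\varepsilon_2 ,$$ that is, $\beta^2=b_1^2+b_2^2+1$ for $C\ell_{2,0}$, $\beta^2=-b_1^2+b_2^2-1$ for $C\ell_{1,1}$, and $\beta^2=-b_1^2-b_2^2+1$ for $C\ell_{0,2}$. In particular there is no solution with $\alpha\neq 0$. (3) $n=3$. Write $A=\alpha+b_1e_1+b_2e_2+b_3e_3+c_1e_{23}+c_2e_{31}+c_3e_{12}+\beta e_{123}$ with real coefficients. (3a) If $\alpha=\beta=0$, then $A^2=-1$ if and only if $b_1c_1+b_2c_2+b_3c_3=0$ and $$-1=b_1^2\varepsilon_1+b_2^2\varepsilon_2+b_3^2\varepsilon_3-c_1^2\varepsilon_2\varepsilon_3-c_2^2\varepsilon_3\varepsilon_1-c_3^2\varepsilon_1\varepsilon_2 ,$$ that is, $-1$ equals - $b_1^2+b_2^2+b_3^2-(c_1^2+c_2^2+c_3^2)$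 for $C\ell_{3,0}$, - $b_1^2-b_2^2-b_3^2-(c_1^2-c_2^2-c_3^2)$ for $C\ell_{1,2}$, - $b_1^2+b_2^2-b_3^2+(c_1^2+c_2^2-c_3^2)$ for $C\ell_{2,1}$, - $-(b_1^2+b_2^2+b_3^2)-(c_1^2+c_2^2+c_3^2)$ for $C\ell_{0,3}$. (3b) If $\alpha=0$ and $\beta\neq 0$, then in $C\ell_{3,0}$ and $C\ell_{1,2}$ the only solutions of $A^2=-1$ are $A=\pm e_{123}$, and in $C\ell_{2,1}$ and $C\ell_{0,3}$ there is no solution. (3c) If $\alpha\neq 0$, there is no solution of $A^2=-1$.
   Context: For integers $p,q\ge0$ with $n=p+q$, $C\ell_{p,q}$ is the $2^n$-dimensional real associative unital Clifford algebra generated by the vectors $e_1,\dots,e_n$ of an orthogonal basis of the inner product space $\mathbb{R}^{p,q}$, with relations $e_ie_j=-e_je_i$ for $i\ne j$ and $e_k^2=\varepsilon_k$, where $\varepsilon_k=+1$ for $1\le k\le p$ and $\varepsilon_k=-1$ for $p+1\le k\le n$. Notation: $e_{12}=e_1e_2$, $e_{23}=e_2e_3$, $e_{31}=e_3e_1$, $e_{123}=e_1e_2e_3$. Elements of $C\ell_{p,q}$ are called multivectors; real numbers are identified with multiples of the unit element. *)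

(* Defs.v *)
From HB Require Import structures.
From mathcomp Require Import all_boot all_order all_algebra falgebra.
From mathcomp Require Import reals.
From mathcomp Require Import ring.

Set Implicit Arguments.
Unset Strict Implicit.
Unset Printing Implicit Defensive.

Import GRing.Theory.
Local Open Scope ring_scope.

(* eps R p k = e_k ^ 2; vectors are numbered from 1, and the index k is only
   meaningful for 1 <= k <= p + q. *)
Definition eps (R : realType) (p k : nat) : R := if (k <= p)%N then 1 else -1.

(* The algebra Cl, with vectors e 1, ..., e (p + q), is the Clifford algebra
   Cl_{p,q}. The values of e outside 1 .. p + q are irrelevant. The dimension
   is not determined by the other clauses: for (p, q) = (0, 3) the quaternions,
   with their units i, j, k as e 1, e 2, e 3, satisfy these in dimension 4. *)
Record is_clifford (R : realType) (p q : nat) (Cl : falgType R)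
    (e : nat -> Cl) : Prop := IsClifford {
  clifford_anticomm : forall i j : nat, (1 <= i <= p + q)%N ->
    (1 <= j <= p + q)%N -> i != j -> e i * e j = - (e j * e i);
  clifford_sqr : forall k : nat, (1 <= k <= p + q)%N ->
    e k ^+ 2 = (eps R p k)%:A;
  clifford_gen :
    agenv <<[seq e k | k <- iota 1 (p + q)]>>%VS = {: Cl}%VS;
  clifford_dim : \dim {: Cl} = (2 ^ (p + q))%N
}.

(* Every signature has a Clifford algebra: the functions on the subsets of
   {0, ..., n - 1}, with the group algebra product of the symmetric difference
   group twisted by the signs csgn. The basis function cdelta S stands for the
   increasing product of the e_(i + 1), i in S. *)
Section Existence.
Variables (R : realType) (p q : nat).
Let n := (p + q)%N.
Implicit Types S T U V : {set 'I_n}.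

Definition sdiff S T := [set i | (i \in S) (+) (i \in T)].

Lemma sdiffA : associative sdiff.
Proof. by move=> S T U; apply/setP=> i; rewrite !inE addbA. Qed.
Lemma sdiffC : commutative sdiff.
Proof. by move=> S T; apply/setP=> i; rewrite !inE addbC. Qed.
Lemma sdiff0 S : sdiff set0 S = S.
Proof. by apply/setP=> i; rewrite !inE. Qed.
Lemma sdiffK S : involutive (sdiff S).
Proof. by move=> T; apply/setP=> i; rewrite !inE addbA addbb. Qed.
Lemma sdiffI S : injective (sdiff S). Proof. exact: inv_inj (sdiffK S). Qed.

Definition csgn1 (i j : 'I_n) : R :=
  if (j < i)%N then -1 else if i == j then eps R p i.+1 else 1.
Definition csgn S T : R := \prod_(i in S) \prod_(j in T) csgn1 i j.

Lemma csgn1_sqr i j : csgn1 i j * csgn1 i j = 1.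
Proof. by rewrite /csgn1 /eps; do !case: ifP => _; rewrite ?mulrNN mulr1. Qed.

Lemma prod_sdiff (h : 'I_n -> R) S T : (forall i, h i * h i = 1) ->
  \prod_(i in sdiff S T) h i = (\prod_(i in S) h i) * (\prod_(i in T) h i).
Proof.
move=> hh; rewrite big_mkcond [X in _ = X * _]big_mkcond.
rewrite [X in _ = _ * X]big_mkcond -big_split; apply: eq_bigr => i _ /=.
by rewrite inE; do 2!case: (i \in _); rewrite /= ?hh ?mulr1 ?mul1r.
Qed.

Lemma csgnDr S T U : csgn S (sdiff T U) = csgn S T * csgn S U.
Proof.
rewrite /csgn -big_split; apply: eq_bigr => i _ /=.
by apply: prod_sdiff => j; apply: csgn1_sqr.
Qed.

Lemma csgnDl S T U : csgn (sdiff S T) U = csgn S U * csgn T U.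
Proof.
apply: prod_sdiff => i; rewrite -big_split big1 // => j _; exact: csgn1_sqr.
Qed.

Lemma csgn_sqr S T : csgn S T * csgn S T = 1.
Proof.
rewrite -big_split big1 // => i _.
by rewrite -big_split big1 // => j _; apply: csgn1_sqr.
Qed.

Lemma csgn0l S : csgn set0 S = 1. Proof. by rewrite /csgn big_set0. Qed.
Lemma csgn0r S : csgn S set0 = 1.
Proof. by rewrite /csgn big1 // => i _; rewrite big_set0. Qed.

Definition cliff := {ffun {set 'I_n} -> R^o}.
HB.instance Definition _ := Vector.copy cliff {ffun {set 'I_n} -> R^o}.
Implicit Types x y z : cliff.

Definition cdelta S : cliff := [ffun T => (T == S)%:R].
Definition cmul x y : cliff :=
  [ffun U => \sum_S csgn S (sdiff S U) * x S * y (sdiff S U)].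

Lemma cmulA : associative cmul.
Proof.
move=> x y z; apply/ffunP=> U; rewrite !ffunE; apply/esym.
under eq_bigr => T _ do rewrite ffunE mulr_sumr mulr_suml.
rewrite exchange_big /=; apply: eq_bigr => S _; rewrite ffunE mulr_sumr.
rewrite (reindex_inj (@sdiffI S)) /=; apply: eq_bigr => V _.
rewrite sdiffK -[sdiff (sdiff S V) U]sdiffA.
have -> : sdiff S (sdiff V U) = sdiff V (sdiff S U).
  by rewrite !sdiffA (sdiffC S).
have -> : csgn S (sdiff S U) = csgn S V * csgn S (sdiff V (sdiff S U)).
  by rewrite -csgnDr sdiffK.
rewrite csgnDl; ring.
Qed.

Lemma cdeltaM S T :
  cmul (cdelta S) (cdelta T) = csgn S T *: cdelta (sdiff S T).
Proof.
apply/ffunP=> U; rewrite !ffunE (bigD1 S) //= big1 ?addr0.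
  rewrite !ffunE eqxx mulr1 -(inj_eq (@sdiffI S)) sdiffK.
  by case: eqP => [->|_]; rewrite ?sdiffK ?mulr0 // scaler0.
by move=> V /negPf SV; rewrite !ffunE SV mulr0 mul0r.
Qed.

Lemma cmul1x : left_id (cdelta set0) cmul.
Proof.
move=> x; apply/ffunP=> U; rewrite !ffunE (bigD1 set0) //= big1 ?addr0.
  by rewrite !ffunE eqxx sdiff0 csgn0l !mul1r.
by move=> V /negPf V0; rewrite !ffunE V0 mulr0 mul0r.
Qed.

Lemma cmulx1 : right_id (cdelta set0) cmul.
Proof.
move=> x; apply/ffunP=> U; rewrite !ffunE (bigD1 U) //= big1 ?addr0.
  have -> : sdiff U U = set0 by apply/setP=> i; rewrite !inE addbb.
  by rewrite !ffunE eqxx csgn0r mulr1 mul1r.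
move=> V VU; rewrite !ffunE -(inj_eq (@sdiffI V)) sdiffK (sdiffC V set0) sdiff0.
by rewrite eq_sym (negPf VU) mulr0.
Qed.

Lemma cmulDl : left_distributive cmul +%R.
Proof.
move=> x y z; apply/ffunP=> U; rewrite !ffunE -big_split.
by apply: eq_bigr => S _; rewrite ffunE mulrDr mulrDl.
Qed.

Lemma cmulDr : right_distributive cmul +%R.
Proof.
move=> x y z; apply/ffunP=> U; rewrite !ffunE -big_split.
by apply: eq_bigr => S _; rewrite ffunE mulrDr.
Qed.

Lemma cone_neq0 : cdelta set0 != 0.
Proof.
apply/eqP=> /ffunP/(_ set0); rewrite !ffunE eqxx => /eqP.
by rewrite oner_eq0.
Qed.

HB.instance Definition _ := GRing.Zmodule_isNzRing.Build cliff
  cmulA cmul1x cmulx1 cmulDl cmulDr cone_neq0.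

Lemma cscalerAl (a : R) x y : a *: (x * y) = (a *: x) * y.
Proof.
apply/ffunP=> U; rewrite !ffunE scaler_sumr; apply: eq_bigr => S _.
by rewrite ffunE /GRing.scale /=; ring.
Qed.
HB.instance Definition _ := GRing.Lmodule_isLalgebra.Build R cliff cscalerAl.

Lemma cscalerAr (a : R) x y : a *: (x * y) = x * (a *: y).
Proof.
apply/ffunP=> U; rewrite !ffunE scaler_sumr; apply: eq_bigr => S _.
by rewrite ffunE /GRing.scale /=; ring.
Qed.
HB.instance Definition _ := GRing.Lalgebra_isAlgebra.Build R cliff cscalerAr.
HB.instance Definition _ := Algebra_isFalgebra.Build R cliff.

Definition cgen (k : nat) : cliff := cdelta [set i : 'I_n | i.+1 == k].

Lemma cgen_ord (i : 'I_n) : cgen i.+1 = cdelta [set i].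
Proof. by congr cdelta; apply/setP=> j; rewrite !inE eqSS. Qed.

Lemma clifford_exists : exists (Cl : falgType R) (e : nat -> Cl),
  is_clifford p q e.
Proof.
exists cliff, cgen.
have ordE k : (1 <= k <= n)%N -> exists i : 'I_n, k = i.+1.
  by case: k => // k lt_kn; exists (Ordinal lt_kn).
have csgn_set1 (i j : 'I_n) : csgn [set i] [set j] = csgn1 i j.
  by rewrite /csgn !big_set1.
split.
- move=> _ _ /ordE[i ->] /ordE[j ->]; rewrite eqSS => neq_ij.
  rewrite !cgen_ord ![_ * _]cdeltaM sdiffC -scaleNr; congr (_ *: _).
  rewrite !csgn_set1 /csgn1.
  rewrite -!val_eqE /= eq_sym; rewrite eq_sym in neq_ij.
  by case: ltngtP neq_ij => // _ _; rewrite opprK.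
- move=> _ /ordE[i ->]; rewrite cgen_ord expr2 [_ * _]cdeltaM.
  rewrite csgn_set1 /csgn1 ltnn eqxx; congr (_ *: cdelta _).
  by apply/setP=> j; rewrite !inE addbb.
- apply/eqP; rewrite eqEsubv subvf /=; set G := agenv _.
  have GM : {in G &, forall x y, x * y \in G}.
    by move=> x y Gx Gy; rewrite -[G]agenvM memv_mul.
  have G1 : cdelta set0 \in G by rewrite memvE sub1_agenv.
  have Gg i : cdelta [set i] \in G.
    apply: (subvP (sub_agenv _)); rewrite memv_span // -cgen_ord.
    by rewrite map_f // mem_iota add1n; apply: ltn_ord.
  have Gd S : cdelta S \in G.
    elim: {S}_.+1 {-2}S (ltnSn #|S|) => // m IHm S leSm.
    have [->|[i Si]] := set_0Vmem S; first exact: G1.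
    have GS' : cdelta (S :\ i) \in G.
      by apply: IHm; rewrite (cardsD1 i S) Si in leSm.
    have := memvZ (csgn [set i] (S :\ i)) (GM _ _ (Gg i) GS').
    rewrite [_ * _]cdeltaM scalerA csgn_sqr scale1r.
    rewrite (_ : sdiff _ _ = S) //.
    by apply/setP=> j; rewrite !inE; case: eqP => [->|]; rewrite ?Si.
  apply/subvP=> x _; rewrite (_ : x = \sum_S (x S : R) *: cdelta S).
    by apply: memv_suml => S _; apply: memvZ.
  apply/ffunP=> U; rewrite sum_ffunE (bigD1 U) //= big1 ?addr0.
    by rewrite !ffunE eqxx /GRing.scale /= mulr1.
  by move=> V /negPf VU; rewrite !ffunE eq_sym VU scaler0.
- by rewrite dimvf /dim /= muln1 -cardsT -powersetT card_powerset cardsT card_ord.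
Qed.

End Existence.

(* Main.v *)
Require Import Defs.
From mathcomp Require Import all_boot all_order all_algebra falgebra.
From mathcomp Require Import reals.
From mathcomp Require Import ssrAC ring lra.

(** For n = 3 the volume element I = e123 is central, so that, with
    I e1 = eps_1 e23 and its cyclic analogues,
      A = (alpha + beta I) + V1 + V2 + V3,   V1 = b1 e1 + c1 e23, ...,
    where the V_i are multiples of e_i over the centre and hence anticommute
    pairwise. Thus
      A^2 = (alpha + beta I)^2 + V1^2 + V2^2 + V3^2
            + 2 (alpha + beta I) (V1 + V2 + V3),
    where every square is central and every (alpha + beta I) V_i in the span of
    e_i and its dual bivector. The case n = 2 has the same shape, with the
    centre replaced by R and V1, V2, V3 by multiples of e1, e2, e12. Comparing
    coefficients in the basis turns A^2 = -1 into a system of real equations,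
    which contains (alpha + beta I) V_i = 0 for each i. Let alpha <> 0. If
    I^2 = -1, the centre is a field, so that each V_i is 0 and
    (alpha + beta I)^2 = -1, which is impossible. If I^2 = 1, the system makes
    the scalar part of V1^2 + V2^2 + V3^2 equal to 2 beta^2, so that A^2 has a
    positive scalar part. *)

Import Order.TTheory GRing.Theory Num.Theory.
Local Open Scope ring_scope.

Set Implicit Arguments.
Unset Strict Implicit.

(** * Spanning families, linear independence and squares of sums *)

(** A subspace that contains 1 and is stable under left multiplication by the generators contains
    every word in them. By bilinearity, stability need only be checked on the finitely many products
    of a generator and a member of [X]. *)
Lemma agenv_span_sub {K : fieldType} {L : falgType K} (s X : seq L) :
  1 \in <<X>>%VS ->
  {in s & X, forall x y, x * y \in <<X>>%VS} ->
  (agenv <<s>> <= <<X>>)%VS.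
Proof.
move=> X1 sX; apply: agenv_sub_modl; first by rewrite -memvE.
apply/prodvP => u v.
move=> /(@coord_span _ _ _ (in_tuple s)) ->.
move=> /(@coord_span _ _ _ (in_tuple X)) ->.
rewrite mulr_suml; apply: memv_suml => i _.
rewrite mulr_sumr; apply: memv_suml => j _.
by rewrite -scalerAl -scalerAr !memvZ // sX // mem_nth.
Qed.

Lemma free_coef0 {K : fieldType} {V : vectType K} (X : seq V) (k : seq K) :
  free X -> \sum_(i < size X) k`_i *: X`_i = 0 ->
  forall i, (i < size X)%N -> k`_i = 0.
Proof.
move=> /(@freeP _ _ _ (in_tuple X)) freeX /freeX k0 i iX.
exact: (k0 (Ordinal iX)).
Qed.

Lemma sqrrD_anticomm (K : nzRingType) (x y : K) :
  x * y = - (y * x) -> (x + y) ^+ 2 = x ^+ 2 + y ^+ 2.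
Proof.
by move=> xy; rewrite !expr2 mulrDl !mulrDr xy addrA subrK.
Qed.

(** The common shape of the squares for n = 2 and n = 3: the cross terms among the [x1], [x2], [x3]
    cancel, and those with [z] double. *)
Lemma sqrrD_anticomm3 (K : nzRingType) (z x1 x2 x3 : K) :
  z * x1 = x1 * z -> z * x2 = x2 * z -> z * x3 = x3 * z ->
  x1 * x2 = - (x2 * x1) -> x1 * x3 = - (x3 * x1) -> x2 * x3 = - (x3 * x2) ->
  (z + (x1 + x2 + x3)) ^+ 2 =
  z ^+ 2 + (x1 ^+ 2 + x2 ^+ 2 + x3 ^+ 2) + (z * x1 + z * x2 + z * x3) *+ 2.
Proof.
move=> zx1 zx2 zx3 x12 x13 x23.
have <- : (x1 + x2 + x3) ^+ 2 = x1 ^+ 2 + x2 ^+ 2 + x3 ^+ 2.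
  by rewrite !sqrrD_anticomm // mulrDl mulrDr x13 x23 opprD.
have : (x1 + x2 + x3) * z = z * (x1 + x2 + x3).
  by rewrite !mulrDr !mulrDl zx1 zx2 zx3.
rewrite -!mulrDr; move: (x1 + x2 + x3) => x xz.
by rewrite !expr2 mulrDl !mulrDr xz mulr2n (AC (2*2) ((1*4)*(2*3))).
Qed.

(** * Bases and squares in an algebra with two or three anticommuting generators *)

Section Generators.
Variables (K : fieldType) (L : falgType K).

Section Two.
Variables (a b : L) (s1 s2 : K).
Hypotheses (aa : a ^+ 2 = s1%:A) (bb : b ^+ 2 = s2%:A) (ab : a * b = - (b * a)).

(** Left multiplication by [a] or [b] sends each of the four products to a scalar multiple of one of
    them, so they span. Being as many as the dimension, they are also independent. *)
Lemma basis_cl2 : agenv <<[:: a; b]>>%VS = {: L}%VS -> \dim {: L} = 4 ->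
  basis_of {: L} [:: 1; a; b; a * b].
Proof.
move=> gen dimL; rewrite basisEdim dimL andbT -gen.
have ba : b * a = - (a * b) by rewrite ab opprK.
have memX x : x \in [:: 1; a; b; a * b] ->
    x \in <<[:: 1%R; a; b; (a * b)%R]>>%VS.
  exact: memv_span.
apply: agenv_span_sub; first by rewrite memX ?inE ?eqxx ?orbT.
apply/allrelP; move: (span _) memX => S memX.
rewrite !(allrel_consl, allrel_consr, allrel0l, allrel0r) /= !mulr1.
rewrite !(mulrA a a) !(mulrA b a) -!expr2 aa bb ba.
rewrite mulNr -(mulrA a b) -expr2 bb mulr_algl mulr_algr.
by rewrite !(memvN, memvZ, memX) // !inE eqxx ?orbT.
Qed.

Lemma sqr_cl2 (r x y t : K) :
  (r%:A + x *: a + y *: b + t *: (a * b)) ^+ 2 =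
  (r ^+ 2 + x ^+ 2 * s1 + y ^+ 2 * s2 - t ^+ 2 * (s1 * s2))%:A
  + (2 * (r * x)) *: a + (2 * (r * y)) *: b + (2 * (r * t)) *: (a * b).
Proof.
have ba : b * a = - (a * b) by rewrite ab opprK.
have aba : a * b * a = - (s1 *: b).
  by rewrite -mulrA ba mulrN mulrA -expr2 aa mulr_algl.
have bab : b * (a * b) = - (s2 *: a).
  by rewrite mulrA ba mulNr -mulrA -expr2 bb mulr_algr.
have aab : a * (a * b) = s1 *: b by rewrite mulrA -expr2 aa mulr_algl.
have abb : a * b * b = s2 *: a by rewrite -mulrA -expr2 bb mulr_algr.
have abab : (a * b) ^+ 2 = - (s1 * s2)%:A.
  by rewrite expr2 mulrA aba mulNr -scalerAl -expr2 bb scalerA.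
rewrite -2!(addrA r%:A) sqrrD_anticomm3.
all: rewrite ?exprZn ?mulr_algl ?mulr_algr -?scalerAl -?scalerAr ?scalerA //.
all: try by rewrite ?ba ?aba ?bab ?aab ?abb ?scalerN ?opprK // mulrC.
rewrite expr1n aa bb abab !(scalerN, scalerA) !(scalerDl, scaleNr).
by rewrite !mulrnDl !mulr_natl !scalerMnl !addrA.
Qed.
End Two.

(* Lemmas on the first part [x *: a + y *: (b * c)] are used for the other two
    by rotating (a, b, c). *)
Section Three.
Variables (a b c : L) (s1 s2 s3 : K).
Hypotheses (aa : a ^+ 2 = s1%:A) (bb : b ^+ 2 = s2%:A) (cc : c ^+ 2 = s3%:A).
Hypotheses (ab : a * b = - (b * a)) (ac : a * c = - (c * a)).
Hypothesis (bc : b * c = - (c * b)).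

Let ba : b * a = - (a * b). Proof. by rewrite ab opprK. Qed.
Let ca : c * a = - (a * c). Proof. by rewrite ac opprK. Qed.
Let cb : c * b = - (b * c). Proof. by rewrite bc opprK. Qed.
Let baA x : b * (a * x) = - (a * (b * x)).
Proof. by rewrite mulrA ba mulNr mulrA. Qed.
Let caA x : c * (a * x) = - (a * (c * x)).
Proof. by rewrite mulrA ca mulNr mulrA. Qed.
Let cbA x : c * (b * x) = - (b * (c * x)).
Proof. by rewrite mulrA cb mulNr mulrA. Qed.
Let aA x : a * (a * x) = s1 *: x.
Proof. by rewrite mulrA -expr2 aa mulr_algl. Qed.
Let bA x : b * (b * x) = s2 *: x.
Proof. by rewrite mulrA -expr2 bb mulr_algl. Qed.
Let cA x : c * (c * x) = s3 *: x.
Proof. by rewrite mulrA -expr2 cc mulr_algl. Qed.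
Let a2 : a * a = s1%:A. Proof. by rewrite -expr2. Qed.
Let b2 : b * b = s2%:A. Proof. by rewrite -expr2. Qed.
Let c2 : c * c = s3%:A. Proof. by rewrite -expr2. Qed.
Let ZA k (x y : L) : (k *: x) * y = k *: (x * y).
Proof. by rewrite scalerAl. Qed.
Let AZ k (x y : L) : x * (k *: y) = k *: (x * y).
Proof. by rewrite scalerAr. Qed.
(** Rewriting rules that sort a right-nested word into the order [a], [b], [c], replace squares by
    scalars and pull scalars and signs out. The variants ending in [A] act at the head of a longer
    word. *)
Let reorder := (ba, ca, cb, baA, caA, cbA, aA, bA, cA, a2, b2, c2,
  @mulNr L, @mulrN L, @opprK L, ZA, AZ, @scalerN K L, @scalerA K L).

Lemma basis_cl3 : agenv <<[:: a; b; c]>>%VS = {: L}%VS -> \dim {: L} = 8 ->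
  basis_of {: L} [:: 1; a; b; c; b * c; c * a; a * b; a * b * c].
Proof.
move=> gen dimL; rewrite basisEdim dimL andbT -gen.
have := @memv_span _ _ [:: 1; a; b; c; b * c; c * a; a * b; a * b * c].
move=> memX; apply: agenv_span_sub; first by rewrite memX ?inE ?eqxx ?orbT.
(* Abstracting the span as [S] shields the products in its family from the rewriting below. *)
apply/allrelP; move: (span _) memX => S memX.
(* The normal forms of [reorder] use [a * c] and [a * (b * c)] where the basis has [c * a] and
   [a * b * c]; they differ by a sign and by associativity. *)
have memS x : x \in [:: 1; a; b; c; b * c; a * c; a * b; a * (b * c)] ->
    x \in S.
  rewrite !inE; do ![case/orP] => /eqP->; rewrite ?mulrA ?ac ?memvN;
    by rewrite memX // !inE eqxx ?orbT.
rewrite !(allrel_consl, allrel_consr, allrel0l, allrel0r) /= !mulr1 -!mulrA.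
rewrite !reorder ?mulr1.
by rewrite !(memvN, memvZ, memS) // !inE eqxx ?orbT.
Qed.

(** Moving [a] past [b] and [c] costs two signs. This identifies the volume elements of the rotated
    triples with the original one. *)
Lemma cl3_volume_cyclic : b * c * a = a * b * c.
Proof. by rewrite -!mulrA !reorder. Qed.

Lemma cl3_volume_sqr : (a * b * c) ^+ 2 = - (s1 * s2 * s3)%:A.
Proof. by rewrite expr2 -!mulrA !reorder mulrA. Qed.

Lemma cl3_center_sqr (r t : K) :
  (r%:A + t *: (a * b * c)) ^+ 2 =
  (r ^+ 2 - t ^+ 2 * (s1 * s2 * s3))%:A + (2 * (r * t)) *: (a * b * c).
Proof.
rewrite expr2 mulrDl !mulrDr !mulr_algl !mulr_algr !ZA !AZ -expr2.
rewrite cl3_volume_sqr !(scalerN, scalerA) mulr2n mulrDl mul1r.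
by rewrite !scalerDl scaleNr (AC (2*2) (1*4*(2*3))) /= mulrA -!expr2.
Qed.

Lemma cl3_volumeC : a * b * c * a = a * (a * b * c).
Proof. by rewrite -!mulrA !reorder. Qed.

Lemma cl3_volume_vec : a * b * c * a = s1 *: (b * c).
Proof. by rewrite -!mulrA !reorder. Qed.

Lemma cl3_volume_bivec : a * b * c * (b * c) = - ((s2 * s3) *: a).
Proof. by rewrite -!mulrA !reorder ?mulr1. Qed.

Lemma cl3_volume_bivecC : b * c * (a * b * c) = - ((s2 * s3) *: a).
Proof. by rewrite -!mulrA !reorder ?mulr1. Qed.

Lemma cl3_part_sqr (x y : K) :
  (x *: a + y *: (b * c)) ^+ 2 =
  (x ^+ 2 * s1 - y ^+ 2 * (s2 * s3))%:A + (2 * (x * y)) *: (a * b * c).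
Proof.
have bcbc : b * c * (b * c) = - (s2 * s3)%:A.
  by rewrite -!mulrA !reorder.
rewrite expr2 mulrDl !mulrDr !ZA !AZ a2 bcbc (mulrA a) cl3_volume_cyclic.
rewrite !(scalerN, scalerA) (mulrC y x) mulr2n mulrDl mul1r !scalerDl scaleNr.
by rewrite (AC (2*2) (1*4*(2*3))) /= !mulrA -!expr2.
Qed.

Lemma cl3_center_part (r t x y : K) :
  (r%:A + t *: (a * b * c)) * (x *: a + y *: (b * c)) =
  (r * x - t * y * (s2 * s3)) *: a + (r * y + t * x * s1) *: (b * c).
Proof.
rewrite mulrDl !mulrDr !ZA !AZ !mul1r !scalerA.
rewrite cl3_volume_vec cl3_volume_bivec scalerN !scalerA !scalerDl scaleNr.
by rewrite addrA (ACl ((1*4)*(2*3))%AC).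
Qed.

Lemma cl3_center_partC (r t x y : K) :
  (r%:A + t *: (a * b * c)) * (x *: a + y *: (b * c)) =
  (x *: a + y *: (b * c)) * (r%:A + t *: (a * b * c)).
Proof.
rewrite !mulrDl !mulrDr !mulr_algl !mulr_algr !ZA !AZ.
rewrite cl3_volumeC cl3_volume_bivec cl3_volume_bivecC !scalerN !scalerA.
by rewrite (mulrC t x) (mulrC t y) (AC (2*2) ((1*3)*(2*4))).
Qed.

Lemma cl3_part_anticomm (x y x' y' : K) :
  (x *: a + y *: (b * c)) * (x' *: b + y' *: (c * a)) =
  - ((x' *: b + y' *: (c * a)) * (x *: a + y *: (b * c))).
Proof.
rewrite !mulrDl !mulrDr !ZA !AZ -!mulrA !reorder ?mulr1 !opprD.
by rewrite !(mulrC x') !(mulrC y') opprK [in RHS](AC (2*2) ((1*3)*(2*4))).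
Qed.
End Three.

Lemma sqr_cl3 (a b c : L) (s1 s2 s3 : K) :
  a ^+ 2 = s1%:A -> b ^+ 2 = s2%:A -> c ^+ 2 = s3%:A ->
  a * b = - (b * a) -> a * c = - (c * a) -> b * c = - (c * b) ->
  forall r x1 x2 x3 y1 y2 y3 t : K,
  (r%:A + x1 *: a + x2 *: b + x3 *: c
   + y1 *: (b * c) + y2 *: (c * a) + y3 *: (a * b) + t *: (a * b * c)) ^+ 2 =
  (r ^+ 2 - t ^+ 2 * (s1 * s2 * s3)
   + (x1 ^+ 2 * s1 + x2 ^+ 2 * s2 + x3 ^+ 2 * s3
      - y1 ^+ 2 * s2 * s3 - y2 ^+ 2 * s3 * s1 - y3 ^+ 2 * s1 * s2))%:A
  + (2 * (r * x1 - t * y1 * (s2 * s3))) *: a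
  + (2 * (r * x2 - t * y2 * (s3 * s1))) *: b
  + (2 * (r * x3 - t * y3 * (s1 * s2))) *: c
  + (2 * (r * y1 + t * x1 * s1)) *: (b * c)
  + (2 * (r * y2 + t * x2 * s2)) *: (c * a)
  + (2 * (r * y3 + t * x3 * s3)) *: (a * b)
  + (2 * (r * t + (x1 * y1 + x2 * y2 + x3 * y3))) *: (a * b * c).
Proof.
move=> aa bb cc ab ac bc r x1 x2 x3 y1 y2 y3 t.
have ba : b * a = - (a * b) by rewrite ab opprK.
have ca : c * a = - (a * c) by rewrite ac opprK.
have cb : c * b = - (b * c) by rewrite bc opprK.
have bca := cl3_volume_cyclic ab ac.
have cab := cl3_volume_cyclic bc ba.
have partC2 := cl3_center_partC bb cc aa bc ba ca.
have partC3 := cl3_center_partC cc aa bb ca cb ab.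
have center2 := cl3_center_part bb cc aa bc ba ca.
have center3 := cl3_center_part cc aa bb ca cb ab.
have sqr2 := cl3_part_sqr bb cc aa bc ba ca.
have sqr3 := cl3_part_sqr cc aa bb ca cb ab.
(* The instances for the triples (b, c, a) and (c, a, b) mention their own volume elements, which
   are brought to [a * b * c]. *)
rewrite cab bca in partC3 center3 sqr3; rewrite bca in partC2 center2 sqr2.
(* The terms are regrouped as the central part followed by each vector paired with its dual
   bivector. *)
rewrite (ACl ((1*8)*((2*5)*(3*6)*(4*7)))%AC) /=.
rewrite sqrrD_anticomm3; first last.
- exact: (cl3_part_anticomm bb cc aa).
(* Rotation yields this pair with the third part on the left, hence the double negation. *)
- by rewrite (cl3_part_anticomm cc aa bb) // opprK.
- exact: (cl3_part_anticomm aa bb cc).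
- exact: partC3.
- exact: partC2.
- exact: (cl3_center_partC aa bb cc).
rewrite (cl3_center_part aa bb cc) // center2 center3.
rewrite (cl3_part_sqr aa bb cc) // sqr2 sqr3 (cl3_center_sqr aa bb cc) //.
have zD p q p' q' : (p%:A + q *: (a * b * c)) + (p'%:A + q' *: (a * b * c)) =
    (p + p')%:A + (q + q') *: (a * b * c) by rewrite !scalerDl addrACA.
rewrite !zD !mulrnDl !scalerMnl.
rewrite [RHS](ACl ((1*8)*((2*5)*(3*6)*(4*7)))%AC) /=.
by congr (_%:A + _ *: _
  + (_ *: _ + _ *: _ + (_ *: _ + _ *: _) + (_ *: _ + _ *: _))); ring.
Qed.
End Generators.

(** * The equation A^2 = -1 as a system of real equations *)

Section SquareRoots.
Variables (R : realType) (L : falgType R).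
Implicit Types (a b c : L) (s r x y t : R).

Lemma cl1_sqr_eqN1 a s r x : a ^+ 2 = s%:A -> free [:: 1; a] ->
  (r%:A + x *: a) ^+ 2 = -1 <-> r ^+ 2 + x ^+ 2 * s = -1 /\ r * x = 0.
Proof.
move=> aa fr.
have -> : (r%:A + x *: a) ^+ 2 =
    (r ^+ 2 + x ^+ 2 * s)%:A + (2 * (r * x)) *: a.
  rewrite expr2 mulrDl !mulrDr !mulr_algl !mulr_algr -scalerAl -scalerAr -expr2.
  rewrite aa !scalerA (AC (2*2) (1*4*(2*3))) /= -!scalerDl !expr2.
  by congr (_%:A + _ *: _); ring.
split=> [A2|[-> ->]]; last by rewrite mulr0 scale0r addr0 scaleN1r.
(* These are the coefficients of A^2 + 1, whose vanishing is to be read off; the cases of two and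
   three generators proceed in the same way. *)
have := @free_coef0 _ _ [:: 1; a] [:: r ^+ 2 + x ^+ 2 * s + 1; 2 * (r * x)] fr.
rewrite !big_ord_recl big_ord0 /= addr0 scalerDl scale1r addrAC A2 addNr.
move=> /(_ erefl) k0.
by have := k0 0%N isT; have := k0 1%N isT => /=; split; lra.
Qed.

Lemma cl2_sqr_eqN1 a b s1 s2 r x y t :
  a ^+ 2 = s1%:A -> b ^+ 2 = s2%:A -> a * b = - (b * a) ->
  free [:: 1; a; b; a * b] ->
  (r%:A + x *: a + y *: b + t *: (a * b)) ^+ 2 = -1 <->
  r ^+ 2 + x ^+ 2 * s1 + y ^+ 2 * s2 - t ^+ 2 * (s1 * s2) = -1 /\
  [/\ r * x = 0, r * y = 0 & r * t = 0].
Proof.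
move=> aa bb ab fr; rewrite (sqr_cl2 aa bb ab).
split=> [A2|[-> [-> -> ->]]]; last by rewrite mulr0 !scale0r !addr0 scaleN1r.
set k := r ^+ 2 + _ + _ - _ in A2 *.
have := @free_coef0 _ _ [:: 1; a; b; a * b]
  [:: k + 1; 2 * (r * x); 2 * (r * y); 2 * (r * t)] fr.
rewrite !big_ord_recl big_ord0 /= addr0 scalerDl scale1r addrAC !addrA.
rewrite A2 addNr => /(_ erefl) k0.
have := k0 3 isT; have := k0 2 isT.
have := k0 1%N isT; have := k0 0%N isT => /=.
by move=> *; do ![split]; lra.
Qed.

Lemma cl3_sqr_eqN1 a b c s1 s2 s3 r x1 x2 x3 y1 y2 y3 t :
  a ^+ 2 = s1%:A -> b ^+ 2 = s2%:A -> c ^+ 2 = s3%:A ->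
  a * b = - (b * a) -> a * c = - (c * a) -> b * c = - (c * b) ->
  free [:: 1; a; b; c; b * c; c * a; a * b; a * b * c] ->
  (r%:A + x1 *: a + x2 *: b + x3 *: c
   + y1 *: (b * c) + y2 *: (c * a) + y3 *: (a * b) + t *: (a * b * c)) ^+ 2
    = -1 <->
  [/\ r ^+ 2 - t ^+ 2 * (s1 * s2 * s3)
       + (x1 ^+ 2 * s1 + x2 ^+ 2 * s2 + x3 ^+ 2 * s3
          - y1 ^+ 2 * s2 * s3 - y2 ^+ 2 * s3 * s1 - y3 ^+ 2 * s1 * s2) = -1,
      r * t + (x1 * y1 + x2 * y2 + x3 * y3) = 0,
      [/\ r * x1 = t * y1 * (s2 * s3), r * x2 = t * y2 * (s3 * s1)
        & r * x3 = t * y3 * (s1 * s2)]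
    & [/\ r * y1 + t * x1 * s1 = 0, r * y2 + t * x2 * s2 = 0
        & r * y3 + t * x3 * s3 = 0]].
Proof.
move=> aa bb cc ab ac bc fr; rewrite (sqr_cl3 aa bb cc ab ac bc).
split=> [A2|[-> -> [-> -> ->] [-> -> ->]]]; last first.
  by rewrite !subrr !mulr0 !scale0r !addr0 scaleN1r.
set k := r ^+ 2 - _ + _ in A2 *.
have := @free_coef0 _ _ [:: 1; a; b; c; b * c; c * a; a * b; a * b * c]
  [:: k + 1; 2 * (r * x1 - t * y1 * (s2 * s3));
   2 * (r * x2 - t * y2 * (s3 * s1)); 2 * (r * x3 - t * y3 * (s1 * s2));
   2 * (r * y1 + t * x1 * s1); 2 * (r * y2 + t * x2 * s2);
   2 * (r * y3 + t * x3 * s3);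
   2 * (r * t + (x1 * y1 + x2 * y2 + x3 * y3))] fr.
rewrite !big_ord_recl big_ord0 /= addr0 scalerDl scale1r addrAC !addrA.
rewrite !addrA in A2; rewrite A2 addNr => /(_ erefl) k0.
have := (k0 7 isT, k0 6 isT, k0 5 isT, k0 4 isT, k0 3 isT, k0 2 isT).
move=> /= [[[[[? ?] ?] ?] ?] ?]; have := k0 1%N isT; have := k0 0%N isT.
by rewrite /= /k => ? ?; do ![split]; lra.
Qed.
End SquareRoots.

(** * Vanishing of the real part for n = 3 *)

Lemma eps_cases (R : realType) p k : eps R p k = 1 \/ eps R p k = -1.
Proof. by rewrite /eps; case: ifP; [left | right]. Qed.

Lemma cl3_real_part_eq0 (R : realType) (s1 s2 s3 r x1 x2 x3 y1 y2 y3 t : R) :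
  s1 * s2 * s3 = 1 \/ s1 * s2 * s3 = -1 ->
  r ^+ 2 - t ^+ 2 * (s1 * s2 * s3)
   + (x1 ^+ 2 * s1 + x2 ^+ 2 * s2 + x3 ^+ 2 * s3
      - y1 ^+ 2 * s2 * s3 - y2 ^+ 2 * s3 * s1 - y3 ^+ 2 * s1 * s2) = -1 ->
  r * t + (x1 * y1 + x2 * y2 + x3 * y3) = 0 ->
  r * x1 = t * y1 * (s2 * s3) -> r * x2 = t * y2 * (s3 * s1) ->
  r * x3 = t * y3 * (s1 * s2) ->
  r * y1 + t * x1 * s1 = 0 -> r * y2 + t * x2 * s2 = 0 ->
  r * y3 + t * x3 * s3 = 0 ->
  r = 0.
Proof.
move=> sign scal vol ex1 ex2 ex3 ey1 ey2 ey3.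
apply/eqP/negPn/negP => r0.
(* For V = x e + y e', with e' the dual bivector, V^2 has scalar part x^2 s - y^2 s' and volume
   coefficient 2 x y. The two components of (r + t I) V = 0 relate them. *)
have part s s' x y : r * x = t * y * s' -> r * y + t * x * s = 0 ->
    r * (x ^+ 2 * s - y ^+ 2 * s') = 2 * t * (s * s') * (x * y).
  move=> ex ey; have -> : r * (x ^+ 2 * s - y ^+ 2 * s') =
    r * x * (x * s) - (r * y + t * x * s) * (y * s') + t * x * s * (y * s').
    by ring.
  by rewrite ex ey; ring.
have vec2 : r * (x1 ^+ 2 * s1 + x2 ^+ 2 * s2 + x3 ^+ 2 * s3
    - y1 ^+ 2 * s2 * s3 - y2 ^+ 2 * s3 * s1 - y3 ^+ 2 * s1 * s2) =
    r * - (2 * t ^+ 2 * (s1 * s2 * s3)).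
  transitivity (2 * t * (s1 * s2 * s3) * (x1 * y1 + x2 * y2 + x3 * y3)).
    have := part _ _ _ _ ex1 ey1; have := part _ _ _ _ ex2 ey2.
    by have := part _ _ _ _ ex3 ey3; lra.
  have -> : x1 * y1 + x2 * y2 + x3 * y3 = - (r * t) by lra.
  by ring.
(* With sigma = s1 s2 s3, the scalar equation becomes r^2 - 3 t^2 sigma = -1, which is impossible
   for sigma = -1. *)
move: scal; rewrite (mulfI r0 vec2); have := sqr_ge0 t; have := sqr_ge0 r.
case: sign => sign; last by rewrite sign; lra.
(* Now I^2 = -1, and this is the norm of r + t I in a centre isomorphic to the complex numbers. Only
   the products x_i y_i = 0 are needed: the volume equation then reads r t = 0, which leaves r^2 =
   -1. *)
have n0 : r ^+ 2 + t ^+ 2 != 0.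
  by rewrite gt_eqF // ltr_pwDl ?sqr_ge0 // exprn_even_gt0.
have part0 s s' x y : s * s' = 1 -> r * x = t * y * s' ->
    r * y + t * x * s = 0 -> x * y = 0.
  move=> ss ex ey; apply: (mulfI n0); rewrite mulr0.
  have -> : (r ^+ 2 + t ^+ 2) * (x * y) = (r * x) * (r * y) + t ^+ 2 * x * y.
    by ring.
  have -> : r * y = - (t * x * s) by lra.
  have -> : t ^+ 2 * x * y = t ^+ 2 * x * y * (s * s') by rewrite ss mulr1.
  by rewrite ex; ring.
have xy0 : x1 * y1 + x2 * y2 + x3 * y3 = 0.
  rewrite (part0 _ _ _ _ _ ex1 ey1) ?(part0 _ _ _ _ _ ex2 ey2) //.
  - by rewrite (part0 _ _ _ _ _ ex3 ey3) ?addr0 // -sign; ring.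
  - by rewrite -sign; ring.
  - by rewrite -sign; ring.
have t0 : t = 0 by apply: (mulfI r0); lra.
by rewrite t0; lra.
Qed.

(** * The classification for n = 1, 2, 3 *)

Unset Implicit Arguments.
Set Strict Implicit.

Theorem mainTheorem1 (R : realType) (p q : nat) (Cl : falgType R)
    (e : nat -> Cl) (hCl : is_clifford p q e)
    (hn : (p + q)%N \in [:: 1; 2; 3]%N) :
  let e12 := e 1%N * e 2%N in
  let e23 := e 2%N * e 3%N in
  let e31 := e 3%N * e 1%N in
  let e123 := e 1%N * e 2%N * e 3%N in
  let e1sq := eps R p 1 in
  let e2sq := eps R p 2 in
  let e3sq := eps R p 3 in
  [/\ (* n = 1 *)
      (p + q = 1)%N ->
        ((p, q) = (1, 0)%N -> forall A : Cl, A ^+ 2 <> -1) /\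
        ((p, q) = (0, 1)%N ->
           forall A : Cl, A ^+ 2 = -1 <-> A = e 1%N \/ A = - e 1%N),
      (* n = 2 *)
      (p + q = 2)%N ->
        basis_of {: Cl}%VS [:: 1; e 1%N; e 2%N; e12] /\
        forall alpha b1 b2 beta : R,
        let A := alpha%:A + b1 *: e 1%N + b2 *: e 2%N + beta *: e12 in
        [/\ A ^+ 2 = -1 <->
              alpha = 0 /\
              beta ^+ 2 = b1 ^+ 2 * e2sq + b2 ^+ 2 * e1sq + e1sq * e2sq,
            (p, q) = (2, 0)%N ->
              (A ^+ 2 = -1 <->
               alpha = 0 /\ beta ^+ 2 = b1 ^+ 2 + b2 ^+ 2 + 1),
            (p, q) = (1, 1)%N ->
              (A ^+ 2 = -1 <->
               alpha = 0 /\ beta ^+ 2 = - b1 ^+ 2 + b2 ^+ 2 - 1),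
            (p, q) = (0, 2)%N ->
              (A ^+ 2 = -1 <->
               alpha = 0 /\ beta ^+ 2 = - b1 ^+ 2 - b2 ^+ 2 + 1)
          & alpha != 0 -> A ^+ 2 <> -1]
    & (* n = 3 *)
      (p + q = 3)%N ->
        basis_of {: Cl}%VS
          [:: 1; e 1%N; e 2%N; e 3%N; e23; e31; e12; e123] /\
        forall alpha b1 b2 b3 c1 c2 c3 beta : R,
        let A := alpha%:A + b1 *: e 1%N + b2 *: e 2%N + b3 *: e 3%N
                 + c1 *: e23 + c2 *: e31 + c3 *: e12 + beta *: e123 in
        [/\ alpha = 0 -> beta = 0 ->
              [/\ A ^+ 2 = -1 <->
                    b1 * c1 + b2 * c2 + b3 * c3 = 0 /\
                    -1 = b1 ^+ 2 * e1sq + b2 ^+ 2 * e2sq + b3 ^+ 2 * e3sq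
                         - c1 ^+ 2 * e2sq * e3sq - c2 ^+ 2 * e3sq * e1sq
                         - c3 ^+ 2 * e1sq * e2sq,
                  (p, q) = (3, 0)%N ->
                    (A ^+ 2 = -1 <->
                     b1 * c1 + b2 * c2 + b3 * c3 = 0 /\
                     -1 = b1 ^+ 2 + b2 ^+ 2 + b3 ^+ 2
                          - (c1 ^+ 2 + c2 ^+ 2 + c3 ^+ 2)),
                  (p, q) = (1, 2)%N ->
                    (A ^+ 2 = -1 <->
                     b1 * c1 + b2 * c2 + b3 * c3 = 0 /\
                     -1 = b1 ^+ 2 - b2 ^+ 2 - b3 ^+ 2
                          - (c1 ^+ 2 - c2 ^+ 2 - c3 ^+ 2)),
                  (p, q) = (2, 1)%N ->
                    (A ^+ 2 = -1 <->
                     b1 * c1 + b2 * c2 + b3 * c3 = 0 /\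
                     -1 = b1 ^+ 2 + b2 ^+ 2 - b3 ^+ 2
                          + (c1 ^+ 2 + c2 ^+ 2 - c3 ^+ 2))
                & (p, q) = (0, 3)%N ->
                    (A ^+ 2 = -1 <->
                     b1 * c1 + b2 * c2 + b3 * c3 = 0 /\
                     -1 = - (b1 ^+ 2 + b2 ^+ 2 + b3 ^+ 2)
                          - (c1 ^+ 2 + c2 ^+ 2 + c3 ^+ 2))],
            alpha = 0 -> beta != 0 ->
              ((p, q) = (3, 0)%N \/ (p, q) = (1, 2)%N ->
                 (A ^+ 2 = -1 <-> A = e123 \/ A = - e123)) /\
              ((p, q) = (2, 1)%N \/ (p, q) = (0, 3)%N -> A ^+ 2 <> -1)
          & alpha != 0 -> A ^+ 2 <> -1]].
Proof.
case: hCl => anti sqr gen dim /=.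
split=> n_eq; move: anti sqr gen dim; rewrite n_eq /= => anti sqr gen dim.
- have aa := sqr 1%N isT.
  have bas : basis_of {: Cl} [:: 1; e 1%N].
    rewrite basisEdim dim andbT -gen.
    have := @memv_span _ _ [:: 1; e 1%N] => memX.
    apply: agenv_span_sub; first by rewrite memX ?inE ?eqxx.
    apply/allrelP; move: (span _) memX => S memX.
    rewrite !(allrel_consl, allrel_consr, allrel0l, allrel0r) /= !mulr1 -expr2.
    by rewrite aa memvZ memX // !inE eqxx ?orbT.
  (* For n = 1 the claim concerns an arbitrary A, so its coordinates have to be produced first. *)
  have AE A : exists r x : R, A = r%:A + x *: e 1%N.
    have : A \in <<[:: 1%R; e 1%N]>>%VS by rewrite (span_basis bas) memvf.
    rewrite span_cons span_seq1.
    move=> /memv_addP[_ /vlineP[r ->] [_ /vlineP[x ->] ->]].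
    by exists r, x.
  have sqrA r x := cl1_sqr_eqN1 r x aa (basis_free bas).
  split=> [[p1 _] A|[p0 q1] A]; have [r [x ->]] := AE A.
    move=> /sqrA[]; rewrite /eps p1 /= => rx _.
    by have := sqr_ge0 r; have := sqr_ge0 x; lra.
  split=> [/sqrA[]|].
    rewrite /eps p0 /= => rx /eqP.
    rewrite mulf_eq0 => /orP[]/eqP r0; last first.
      (* Here x = 0, which would give r^2 = -1. *)
      by exfalso; have := sqr_ge0 r; rewrite r0 in rx; lra.
    move: rx; rewrite r0 scale0r add0r expr0n /= => x1.
    have /eqP : x ^+ 2 = 1 by lra.
    rewrite sqrf_eq1 => /orP[]/eqP->; rewrite ?scale1r ?scaleN1r;
      by [left|right].
  by case=> ->; rewrite ?sqrrN aa /eps p0 /= scaleN1r.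
- have aa := sqr 1%N isT; have bb := sqr 2%N isT.
  have ab := anti 1%N 2%N isT isT isT.
  have bas := basis_cl2 aa bb ab gen dim.
  split=> // r x y t.
  have sqrA := cl2_sqr_eqN1 r x y t aa bb ab (basis_free bas).
  (* A nonzero r forces x = y = t = 0, and then r^2 = -1. *)
  have real0 : (r%:A + x *: e 1%N + y *: e 2%N + t *: (e 1%N * e 2%N)) ^+ 2 = -1
      -> r = 0.
    move=> /sqrA[scal [rx ry rt]]; apply/eqP/negPn/negP => r0.
    move: scal; rewrite (mulfI r0 (etrans rx (esym (mulr0 r)))).
    rewrite (mulfI r0 (etrans ry (esym (mulr0 r)))).
    rewrite (mulfI r0 (etrans rt (esym (mulr0 r)))).
    by have := sqr_ge0 r; lra.
  have sqrA0 s : eps R p 1 * eps R p 2 = s ->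
    (r%:A + x *: e 1%N + y *: e 2%N + t *: (e 1%N * e 2%N)) ^+ 2 = -1 <->
    r = 0 /\ t ^+ 2 * s = x ^+ 2 * eps R p 1 + y ^+ 2 * eps R p 2 + 1.
    move=> <-; split=> [A2|[r0 tE]].
      by have r0 := real0 A2; split=> //; move/sqrA: A2 => []; rewrite r0; lra.
    by apply/sqrA; rewrite r0 !mul0r; split=> //; lra.
  split.
  - apply: (iff_trans (sqrA0 _ erefl)).
    (* The two forms of the equation differ by the factor eps_1 eps_2, whose square is 1; each
       choice of signs makes this linear in the squares. *)
    by case: (eps_cases R p 1) => ->; case: (eps_cases R p 2) => ->;
      split=> -[]; split=> //; lra.
  - move=> [pE _]; apply: (iff_trans (sqrA0 _ erefl)); rewrite pE /eps /=.
    by split=> -[]; split=> //; lra.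
  - move=> [pE _]; apply: (iff_trans (sqrA0 _ erefl)); rewrite pE /eps /=.
    by split=> -[]; split=> //; lra.
  - move=> [pE _]; apply: (iff_trans (sqrA0 _ erefl)); rewrite pE /eps /=.
    by split=> -[]; split=> //; lra.
  - by move=> /eqP r0 /real0.
have aa := sqr 1%N isT; have bb := sqr 2%N isT; have cc := sqr 3%N isT.
have ab := anti 1%N 2%N isT isT isT; have ac := anti 1%N 3%N isT isT isT.
have bc := anti 2%N 3%N isT isT isT.
have bas := basis_cl3 aa bb cc ab ac bc gen dim.
split=> // r x1 x2 x3 y1 y2 y3 t.
have sqrA := cl3_sqr_eqN1 r x1 x2 x3 y1 y2 y3 t
  aa bb cc ab ac bc (basis_free bas).
have sign : eps R p 1 * eps R p 2 * eps R p 3 = 1 \/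
            eps R p 1 * eps R p 2 * eps R p 3 = -1.
  by case: (eps_cases R p 1) => ->; case: (eps_cases R p 2) => ->;
    case: (eps_cases R p 3) => ->;
    [left|right|right|left|right|left|left|right]; lra.
split.
- move=> r0 t0; subst r t.
  set A := (X in X ^+ 2).
  have sqrA0 : A ^+ 2 = -1 <->
    x1 * y1 + x2 * y2 + x3 * y3 = 0 /\
    -1 = x1 ^+ 2 * eps R p 1 + x2 ^+ 2 * eps R p 2 + x3 ^+ 2 * eps R p 3
      - y1 ^+ 2 * eps R p 2 * eps R p 3 - y2 ^+ 2 * eps R p 3 * eps R p 1
      - y3 ^+ 2 * eps R p 1 * eps R p 2.
    split=> [/sqrA[]|[]]; first by split; lra.
    by move=> vol scal; apply/sqrA; rewrite !mul0r; do ![split]; lra.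
  split=> // -[pE _]; apply: (iff_trans sqrA0); rewrite pE /eps /=;
    by split=> -[]; split=> //; lra.
- move=> r0 t0; subst r; set A := (X in X ^+ 2).
  have eps0 k : eps R p k != 0.
    by case: (eps_cases R p k) => ->; rewrite ?oppr_eq0 oner_eq0.
  (* With r = 0 the cross terms are t I V_i. As t is nonzero and I invertible, every V_i vanishes,
     and (t I)^2 = -t^2 eps_1 eps_2 eps_3 remains. *)
  have A2E : A ^+ 2 = -1 -> A = t *: (e 1%N * e 2%N * e 3%N) /\
      t ^+ 2 * (eps R p 1 * eps R p 2 * eps R p 3) = 1.
    case/sqrA => scal _ [ex1 ex2 ex3] [ey1 ey2 ey3].
    have y0 y s s' : 0 = t * y * (eps R p s * eps R p s') -> y = 0.
      move=> /esym/eqP; rewrite !mulf_eq0 !(negPf (eps0 _)) (negPf t0) !orbF.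
      by move=> /eqP.
    have x0 x s : 0 + t * x * eps R p s = 0 -> x = 0.
      move=> /eqP; rewrite add0r !mulf_eq0 (negPf (eps0 _)) (negPf t0) orbF.
      by move=> /eqP.
    rewrite !mul0r in ex1 ex2 ex3 ey1 ey2 ey3.
    have y10 := y0 _ _ _ ex1; have y20 := y0 _ _ _ ex2.
    have y30 := y0 _ _ _ ex3.
    have x10 := x0 _ _ ey1; have x20 := x0 _ _ ey2; have x30 := x0 _ _ ey3.
    move: scal; rewrite /A; subst; rewrite !scale0r !add0r => scal.
    by split=> //; lra.
  have I2 := cl3_volume_sqr aa bb cc ab ac bc.
  split=> pq.
    have sign1 : eps R p 1 * eps R p 2 * eps R p 3 = 1.
      by case: pq => -[-> _]; rewrite /eps /=; lra.
    rewrite -/A; split=> [/A2E[-> /eqP]|[]->];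
      rewrite ?sqrrN ?I2 sign1 ?scale1r //.
    rewrite mulr1 sqrf_eq1.
    by case/orP=> /eqP->; rewrite ?scale1r ?scaleN1r; [left|right].
  have signN1 : eps R p 1 * eps R p 2 * eps R p 3 = -1.
    by case: pq => -[-> _]; rewrite /eps /=; lra.
  by move=> /A2E[_]; rewrite signN1; have := sqr_ge0 t; lra.
- move=> /eqP r0 /sqrA[scal vol [ex1 ex2 ex3] [ey1 ey2 ey3]].
  exact: r0 (cl3_real_part_eq0 sign scal vol ex1 ex2 ex3 ey1 ey2 ey3).
Qed.
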